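(* Let $G=\mathbb{Z}/3\mathbb{Z}\star\mathbb{Z}/3\mathbb{Z}$, with $a$ and $b$ generators of the two cyclic factors, and let $\Sigma=\{a,a^2,b,b^2\}$. Let $p\in[0,1/2]$ and let $\mu$ be the probability measure with $\mu(a)=\mu(b)=p$ and $\mu(a^2)=\mu(b^2)=1/2-p$. Then the drift (with respect to $\Sigma$) of the random walk $(G,\mu)$ is $$\gamma=-\frac14+\frac14\sqrt{16p^2-8p+5}.$$
   Context: Random walk $(G,\mu)$: $X_0=1$, $X_{n+1}=X_nx_n$ with $(x_n)$ i.i.d. of law $\mu$. The length $|g|$ of $g\in G$ is its word length with respect to $\Sigma$ (equivalently, the number of letters in its free-product normal form), and the drift is $\gamma=\lim_n|X_n|/n$ (a.s.). *)

(* Defs.v *)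
From HB Require Import structures.
From mathcomp Require Import all_boot all_order all_algebra all_fingroup.
From mathcomp Require Import all_solvable finmap.
From mathcomp Require Import all_classical all_reals all_analysis.
Set Implicit Arguments.
Unset Strict Implicit.
Unset Printing Implicit Defensive.

Import Order.TTheory GRing.Theory Num.Theory numFieldNormedType.Exports.

(** * Free product of two groups

    Elements are normal forms: words in the nontrivial elements of the two
    factors in which consecutive letters come from different factors. *)

Section FreeProductWords.
Local Open Scope group_scope.
Variables A B : groupType.
Implicit Types (l m : (A + B)%type) (u v w : seq (A + B)).

Definition letter_inv l : (A + B)%type :=
  match l with inl x => inl x^-1 | inr y => inr y^-1 end.

Definition letter_nontrivial l : bool :=
  match l with inl x => x != 1 | inr y => y != 1 end.

Definition other_factor l m : bool :=
  match l, m with inl _, inr _ | inr _, inl _ => true | _, _ => false end.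

Definition reduced w : bool :=
  all letter_nontrivial w && sorted other_factor w.

(* The normal form of [l * w], for [w] in normal form and [l] any letter,
   possibly trivial. *)
Definition push l w : seq (A + B) :=
  if ~~ letter_nontrivial l then w else
  match l, w with
  | inl x, inl y :: w' => if x * y == 1 then w' else inl (x * y) :: w'
  | inr x, inr y :: w' => if x * y == 1 then w' else inr (x * y) :: w'
  | _, _ => l :: w
  end.

Definition word_mul u v := foldr push v u.

Definition word_inv u := rev (map letter_inv u).

Lemma reduced_cons l w : reduced (l :: w) =
  [&& letter_nontrivial l, reduced w & path other_factor l w].
Proof.
rewrite /reduced /= -!andbA; congr andb; case: (all _ _) => //=.
by apply/idP/andP => [h|[]//]; split=> //; exact: path_sorted h.
Qed.

Lemma reduced_push l w : reduced w -> reduced (push l w).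
Proof.
rewrite /push; case: ifPn => // /negPn l1 rw.
have rlw : (if w is k :: _ then other_factor l k else true) -> reduced (l :: w).
  rewrite reduced_cons l1 rw; case: w rw => //= m w.
  by rewrite reduced_cons => /and3P[_ _ ->] ->.
case: l l1 rlw => x x1; case: w rw => [|[y|y] w] rw rlw; try exact: rlw.
- move: rw {rlw}; rewrite reduced_cons => /and3P[_ rw pw].
  have [//|xy] := eqVneq (x * y) 1.
  by rewrite reduced_cons rw /= xy; case: w pw {rw} => [|[]].
- move: rw {rlw}; rewrite reduced_cons => /and3P[_ rw pw].
  have [//|xy] := eqVneq (x * y) 1.
  by rewrite reduced_cons rw /= xy; case: w pw {rw} => [|[]].
Qed.

Lemma reduced_mul u v : reduced v -> reduced (word_mul u v).
Proof. by move=> rv; elim: u => //= l u; exact: reduced_push. Qed.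

Lemma push_reduced l w : reduced (l :: w) -> push l w = l :: w.
Proof.
rewrite reduced_cons => /and3P[l1 _]; rewrite /push l1 /=.
by case: l {l1} => x; case: w => [|[y|y] w].
Qed.

Lemma word_mulw1 w : reduced w -> word_mul w [::] = w.
Proof.
elim: w => //= l w IH rw; move: (rw); rewrite reduced_cons => /and3P[_ rw' _].
by rewrite IH // push_reduced.
Qed.

Lemma push_mull x y w : reduced w ->
  push (inl x) (push (inl y) w) = push (inl (x * y)) w.
Proof.
rewrite /push /=.
have [->|x1] := eqVneq x 1; first by rewrite mul1g.
have [->|y1] := eqVneq y 1; first by rewrite mulg1 x1.
case: w => [|[z|z] w] //=; last 1 first.
- by case: (x * y == 1).
- by case: (x * y == 1).
rewrite reduced_cons /= => /and3P[z1 _ pw].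
have [yz|yz] := eqVneq (y * z) 1; last first.
  rewrite mulgA; have [xy|xy] //= := eqVneq (x * y) 1.
  by rewrite xy mul1g (negPf z1).
have -> : x * y * z = x by rewrite -mulgA yz mulg1.
rewrite (negPf x1) /=.
have [xy|xy] := eqVneq (x * y) 1 => /=.
  have -> : x = z by rewrite -[x]mulg1 -yz mulgA xy mul1g.
  by case: w pw => [|[]].
by case: w pw => [|[]].
Qed.

Lemma push_mulr x y w : reduced w ->
  push (inr x) (push (inr y) w) = push (inr (x * y)) w.
Proof.
rewrite /push /=.
have [->|x1] := eqVneq x 1; first by rewrite mul1g.
have [->|y1] := eqVneq y 1; first by rewrite mulg1 x1.
case: w => [|[z|z] w] //=.
- by case: (x * y == 1).
- by case: (x * y == 1).
rewrite reduced_cons /= => /and3P[z1 _ pw].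
have [yz|yz] := eqVneq (y * z) 1; last first.
  rewrite mulgA; have [xy|xy] //= := eqVneq (x * y) 1.
  by rewrite xy mul1g (negPf z1).
have -> : x * y * z = x by rewrite -mulgA yz mulg1.
rewrite (negPf x1) /=.
have [xy|xy] := eqVneq (x * y) 1 => /=.
  have -> : x = z by rewrite -[x]mulg1 -yz mulgA xy mul1g.
  by case: w pw => [|[]].
by case: w pw => [|[]].
Qed.

Lemma pushVK l w : reduced w -> push (letter_inv l) (push l w) = w.
Proof.
by case: l => x rw; rewrite /= ?push_mull ?push_mulr // mulVg /push /= eqxx.
Qed.

Lemma word_mul_push l u v : reduced u -> reduced v ->
  word_mul (push l u) v = push l (word_mul u v).
Proof.
move=> ru rv; rewrite {1}/push; case: ifPn => [|].
  by case: l => x; rewrite /= negbK => /eqP ->; rewrite /push /= eqxx.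
rewrite negbK; case: l => x x1; case: u ru => [|[y|y] u] ru //=.
- rewrite push_mull ?reduced_mul //; case: eqP => //= ->.
  by rewrite /push /= eqxx.
- rewrite push_mulr ?reduced_mul //; case: eqP => //= ->.
  by rewrite /push /= eqxx.
Qed.

Lemma word_mulA u v w : reduced v -> reduced w ->
  word_mul u (word_mul v w) = word_mul (word_mul u v) w.
Proof.
move=> rv rw; elim: u => //= l u ->.
by rewrite word_mul_push // reduced_mul.
Qed.

Lemma reduced_inv w : reduced w -> reduced (word_inv w).
Proof.
rewrite /reduced /word_inv all_rev rev_sorted all_map => /andP[nw sw].
apply/andP; split.
  by apply: sub_all nw => -[] x /=; rewrite invg_eq1.
rewrite sorted_map; apply: sub_sorted sw.
by move=> [] x [] y.
Qed.

Lemma word_invK w : word_inv (word_inv w) = w.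
Proof.
rewrite /word_inv map_rev revK -map_comp map_id_in // => -[] x _ /=;
by rewrite invgK.
Qed.

Lemma word_mulVw w : reduced w -> word_mul (word_inv w) w = [::].
Proof.
elim: w => //= l w IH; move=> rlw; move: (rlw).
rewrite reduced_cons => /and3P[_ rw _].
rewrite /word_inv /= rev_cons /word_mul foldr_rcons.
by rewrite -(push_reduced rlw) pushVK //; exact: IH.
Qed.

End FreeProductWords.

Definition free_product (A B : groupType) := {w : seq (A + B) | reduced w}.

Section FreeProductGroup.
Local Open Scope group_scope.
Variables A B : groupType.
Local Notation G := (free_product A B).

HB.instance Definition _ := Choice.on G.

Definition fp_one : G := Sub [::] isT.

Definition fp_mul (g h : G) : G :=
  Sub (word_mul (val g) (val h)) (reduced_mul (val g) (valP h)).

Definition fp_inv (g : G) : G := Sub (word_inv (val g)) (reduced_inv (valP g)).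

Lemma fp_mulA : associative fp_mul.
Proof. by move=> f g h; apply: val_inj; rewrite /= word_mulA ?(valP g, valP h). Qed.

Lemma fp_mul1g : left_id fp_one fp_mul.
Proof. by move=> g; exact: val_inj. Qed.

Lemma fp_mulg1 : right_id fp_one fp_mul.
Proof. by move=> g; apply: val_inj; rewrite /= word_mulw1 ?(valP g). Qed.

Lemma fp_mulVg : left_inverse fp_one fp_inv fp_mul.
Proof. by move=> g; apply: val_inj; rewrite /= word_mulVw ?(valP g). Qed.

Lemma fp_mulgV : right_inverse fp_one fp_inv fp_mul.
Proof.
move=> g; apply: val_inj; rewrite /= -{1}[val g]word_invK word_mulVw //.
exact: reduced_inv (valP g).
Qed.

HB.instance Definition _ :=
  isGroup.Build G fp_mulA fp_mul1g fp_mulg1 fp_mulVg fp_mulgV.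

Definition fp_inl (x : A) : G :=
  Sub (push (inl x) [::]) (reduced_push (inl x) (isT : reduced [::])).

Definition fp_inr (y : B) : G :=
  Sub (push (inr y) [::]) (reduced_push (inr y) (isT : reduced [::])).

Lemma fp_inlM : {morph fp_inl : x y / x * y >-> x * y}.
Proof.
by move=> x y; apply: val_inj; rewrite [RHS]word_mul_push ?(valP (_ : G)) //= push_mull.
Qed.

Lemma fp_inrM : {morph fp_inr : x y / x * y >-> x * y}.
Proof.
by move=> x y; apply: val_inj; rewrite [RHS]word_mul_push ?(valP (_ : G)) //= push_mulr.
Qed.

Lemma free_product_universal (H : groupType) (f : A -> H) (g : B -> H) :
    {morph f : x y / x * y >-> x * y} -> {morph g : x y / x * y >-> x * y} ->
  exists! h : G -> H,
    [/\ {morph h : x y / x * y >-> x * y}, forall x, h (fp_inl x) = f x &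
        forall y, h (fp_inr y) = g y].
Proof.
move=> fM gM.
have f1 : f 1 = 1 by apply: (mulgI (f 1)); rewrite -fM !mulg1.
have g1 : g 1 = 1 by apply: (mulgI (g 1)); rewrite -gM !mulg1.
pose lev (l : (A + B)%type) := match l with inl x => f x | inr y => g y end.
pose hw := foldr (fun l acc => lev l * acc) 1.
have hwP l w : hw (push l w) = lev l * hw w.
  rewrite /push; case: ifPn => [|_].
    by case: l => x /=; rewrite negbK => /eqP ->; rewrite ?f1 ?g1 mul1g.
  case: l w => x [|[y|y] w] //=.
  - by rewrite mulgA -fM; case: eqP => //= ->; rewrite f1 mul1g.
  - by rewrite mulgA -gM; case: eqP => //= ->; rewrite g1 mul1g.
have hwM u v : hw (word_mul u v) = hw u * hw v.
  by elim: u => [|l u IH] /=; rewrite ?mul1g // hwP IH mulgA.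
exists (fun u => hw (val u)); split.
  split=> [u v|x|y]; first exact: hwM.
  - by rewrite [LHS]hwP /= mulg1.
  - by rewrite [LHS]hwP /= mulg1.
move=> h [hM hl hr]; apply: funext => -[w rw] /=.
elim: w rw => [|l w IH] rw /=.
  have -> : exist _ [::] rw = 1 :> G by exact: val_inj.
  by apply: (mulgI (h 1)); rewrite -hM !mulg1.
have rw' : reduced w by have := rw; rewrite reduced_cons => /and3P[].
have -> : exist _ (l :: w) rw =
    (match l with inl x => fp_inl x | inr y => fp_inr y end) * exist _ w rw' :> G.
  apply/esym/val_inj; case: l rw => x rw;
  by apply: etrans (word_mul_push _ (isT : reduced [::]) rw') (push_reduced rw).
by rewrite hM -IH; case: l {rw} => x; rewrite ?hl ?hr.
Qed.

End FreeProductGroup.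

Arguments fp_inl {A B} x.
Arguments fp_inr {A B} y.

Section FreeProductMeasurable.
Local Open Scope classical_set_scope.
Variables A B : groupType.
Local Notation G := (free_product A B).

HB.instance Definition _ := isPointed.Build G (fp_one A B).

HB.instance Definition _ := @isMeasurable.Build default_measure_display
  G discrete_measurable discrete_measurable0
  discrete_measurableC discrete_measurableU.

End FreeProductMeasurable.

(** * Word length *)

Section WordLength.
Local Open Scope group_scope.
Local Open Scope classical_set_scope.
Variable G : groupType.

Definition is_word (S : set G) (g : G) (n : nat) : Prop :=
  exists s : seq G,
    [/\ size s = n, forall x, x \in s -> S x & \prod_(x <- s) x = g].

(* Word length for a generating set [S] closed under inversion; [0] by
   convention on elements outside the submonoid generated by [S]. *)
Definition word_length (S : set G) (g : G) : nat :=
  xget 0%N [set n | is_word S g n /\ forall m, is_word S g m -> (n <= m)%N].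

End WordLength.

(** * Random walks *)

Section RandomWalk.
Local Open Scope classical_set_scope.
Local Open Scope ring_scope.

Definition mutually_independent d d' (T : measurableType d)
    (E : measurableType d') (R : realType) (P : probability T R)
    (x : nat -> {RV P >-> E}) : Prop :=
  forall (J : {fset nat}) (C : nat -> set E),
    (forall i, measurable (C i)) ->
    P (\bigcap_(i in [set` J]) (x i @^-1` C i)) =
    (\big[mule/1]_(i <- J) P (x i @^-1` C i))%E.

Definition iid_of_law d d' (T : measurableType d) (E : measurableType d')
    (R : realType) (P : probability T R) (mu : probability E R)
    (x : nat -> {RV P >-> E}) : Prop :=
  (forall n (C : set E), measurable C -> distribution P (x n) C = mu C) /\
  mutually_independent x.

(* [x n] is the (n+1)-st step. *)
Fixpoint walk (T : Type) (G : groupType) (x : nat -> T -> G) (n : nat) (t : T)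
    : G :=
  if n is m.+1 then (walk x m t * x m t)%g else 1%g.

(* [gamma] is the drift, for the word length of [S], of the walk with steps
   [x]: almost surely the limit exists and equals [gamma]. *)
Definition is_drift d (T : measurableType d) (R : realType)
    (P : probability T R) (G : groupType) (S : set G) (x : nat -> T -> G)
    (gamma : R) : Prop :=
  {ae P, forall t : T,
    ((word_length S (walk x n t))%:R / n%:R : R) @[n --> \oo] --> gamma}.

End RandomWalk.

(* Main.v *)
(* The word length alone is not of constant drift: by symmetry between the two
   factors its drift depends only on whether the last letter is a generator
   ([a] or [b]) or the square of one. It is corrected by a bounded function of
   the whole word, affine in its value at the word without the last letter:
   [corrector (w l) = c_l * corrector w + beta_l] with [0 < c_l < 1]. The
   coefficients can be chosen so that [F := length + corrector] satisfies
   [E F(X_(n+1)) = F(X_n) + gamma] conditionally on [X_n], with [gamma] the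
   claimed drift, at every word including the empty one. Hence
   [M_n := F(X_n) - F(1) - gamma n] is a martingale with bounded increments, so
   [E M_n^4 = O(n^2)] and [sum_n (M_n / n)^4] is integrable; thus [M_n / n]
   tends to [0] almost surely, and [|X_n| / n] tends to [gamma]. *)
Require Import Defs.
From HB Require Import structures.
From mathcomp Require Import all_boot all_order all_algebra all_fingroup.
From mathcomp Require Import all_solvable finmap zify ring lra.
From mathcomp Require Import all_classical all_reals all_analysis.
From mathcomp Require Import measurable_realfun.

Set Implicit Arguments.
Unset Strict Implicit.
Unset Printing Implicit Defensive.

Import Order.TTheory GRing.Theory Num.Theory numFieldNormedType.Exports.

Local Open Scope classical_set_scope.
Local Open Scope ring_scope.

(** * Generators of the cyclic group of order three *)

Lemma generator_Z3 (z : 'Z_3) : generator [set: 'Z_3]%SET z ->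
  [/\ z != 1%g, (z * z != 1)%g, (z * (z * z) = 1)%g &
      forall y : 'Z_3, y != 1%g -> y = z \/ y = (z * z)%g].
Proof.
move=> /eqP gz.
have z1 : z != 1%g.
  apply/eqP => z1; move/(congr1 (fun B : {set 'Z_3} => #|B|)): gz.
  by rewrite z1 cycle1 cards1 cardsT card_ord.
move: z z1 {gz} => [[|[|[|//]]] i] // _; split=> //; try exact/val_inj.
  by move=> [[|[|[|//]]] j] // _; [left|right]; exact/val_inj.
by move=> [[|[|[|//]]] j] // _; [right|left]; exact/val_inj.
Qed.


(** * Normal forms and word length in a free product *)

Section Words.
Variables A B : groupType.
Implicit Types (l m : (A + B)%type) (u v w : seq (A + B)).
Local Notation G := (free_product A B).

Lemma push_other_factor l w : letter_nontrivial l ->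
  (if w is m :: _ then other_factor l m else true) -> push l w = l :: w.
Proof. by rewrite /push => ->; case: l w => x [|[] y w]. Qed.

(** The first letter of [push l [:: m]], if any, lies in the factor of [l], hence not in that of the
    letter before [l]: no cancellation propagates into [u]. *)
Lemma word_mul_rcons u l m : reduced (rcons u l) -> letter_nontrivial m ->
  word_mul (rcons u l) [:: m] = u ++ push l [:: m].
Proof.
elim: u => //= k u IH; rewrite reduced_cons => /and3P[k1 rul pk] m1.
rewrite IH //; apply: push_other_factor => //.
case: u rul pk {IH} => [|k' u] /=; last by move=> _ /andP[].
rewrite /reduced /= !andbT => l1; rewrite /push l1 /=.
by case: l m k {l1 m1 k1} => x [] y [] t //=; case: eqP.
Qed.

Lemma size_push l w : (size (push l w) <= (size w).+1)%N.
Proof.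
rewrite /push; case: ifP => // _.
by case: l w => x [|[] y w] //=; case: eqP => //= _; lia.
Qed.

Definition fp_letter l : G :=
  match l with inl x => fp_inl x | inr y => fp_inr y end.

Lemma val_fp_letter l : letter_nontrivial l -> val (fp_letter l) = [:: l].
Proof. by case: l => x /= x1; rewrite /push /= x1. Qed.

Lemma prod_fp_letter (g : G) : (\prod_(l <- val g) fp_letter l)%g = g.
Proof.
apply: val_inj; case: g => w rw /=.
elim: w rw => [|l w IH] rw; first by rewrite big_nil.
rewrite big_cons; move: (rw); rewrite reduced_cons => /and3P[l1 rw' _].
rewrite [LHS](_ : _ = word_mul (val (fp_letter l))
  (sval (\prod_(j <- w) fp_letter j)%g)) // val_fp_letter // IH //.
exact: push_reduced.
Qed.

(** Multiplying by one letter lengthens a normal form by at most one, and the normal form is itself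
    a product of that many letters. *)
Lemma word_length_free_product (g : G) :
  word_length [set fp_letter l | l in [set l | letter_nontrivial l]] g =
  size (val g).
Proof.
set S := (X in word_length X).
have lower s : (forall x, x \in s -> S x) ->
    (size (val (\prod_(x <- s) x)%g) <= size s)%N.
  elim: s => [|x s IH] Ss; first by rewrite big_nil.
  rewrite big_cons; have [l l1 <-] := Ss x (mem_head _ _).
  rewrite [val _](_ : _ = word_mul (val (fp_letter l))
    (val (\prod_(j <- s) j)%g)) // val_fp_letter //=.
  apply: leq_trans (size_push _ _) _; rewrite ltnS; apply: IH => y ys.
  by apply: Ss; rewrite inE ys orbT.
rewrite /word_length; apply: xget_unique => /=.
  split; last by move=> m [s [<- Ss <-]]; exact: lower.
  exists (map fp_letter (val g)); split; first by rewrite size_map.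
    move=> x /mapP[l lg ->]; exists l => //.
    by case/andP: (valP g) => /allP /(_ _ lg).
  by rewrite big_map prod_fp_letter.
move=> m [[s [<- Ss <-]] mmin]; apply/eqP; rewrite eqn_leq lower // andbT.
apply: mmin; exists (map fp_letter (val (\prod_(x <- s) x)%g)).
split; rewrite ?size_map //; last by rewrite big_map prod_fp_letter.
move=> x /mapP[l lg ->]; exists l => //.
by case/andP: (valP (\prod_(x <- s) x)%g) => /allP /(_ _ lg).
Qed.

End Words.

(** * Solving for the corrector *)

(* Coefficients of the affine corrector: the unknowns [c] and [1 - c] are the
   contraction factors of the letters of the two types, [beta] the increment of
   the first type and [y0] the value at the empty word. With [sg := s - 1], the
   two equations for [c] amount to [sg ^+ 2 + sg / 2 - 1 / 4 + p * q = 0], whose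
   negative root makes the pair of equations for [beta] compatible exactly when
   [gamma] is the drift. *)
Lemma drift_coefficients (R : rcfType) (p : R) : 0 <= p -> p <= 1 / 2 ->
  exists c beta y0 : R,
  let q := 1 / 2 - p in
  let gamma := - (1 / 4) + 1 / 4 * Num.sqrt (16 * p ^+ 2 - 8 * p + 5) in
  let s := p * c + q * (1 - c) in
  [/\ 0 < c < 1,
      p * (1 - c) + q + (s - 1) * c = 0, q * c + p + (s - 1) * (1 - c) = 0,
      p * beta + (s - 1) * beta = gamma - p /\ q * beta + p * beta = gamma - q &
      1 + (2 * s - 1) * y0 + 2 * p * beta = gamma].
Proof.
move=> p0 p2.
set S := Num.sqrt _.
have S2 : S ^+ 2 = 16 * p ^+ 2 - 8 * p + 5 by rewrite sqr_sqrtr //; nra.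
have S0 : 0 <= S by exact: sqrtr_ge0.
(* [S ^+ 2 = (4 * p - 1) ^+ 2 + 4], whence [2 <= S]. *)
have sq_ge0 := sqr_ge0 (4 * p - 1).
have Sge2 : 2 <= S by rewrite leNgt; apply/negP => ?; nra.
have S5 : S < 3 by rewrite ltNge; apply/negP => ?; nra.
pose q := 1 / 2 - p; pose sg := - (1 / 4) - S / 4.
have sgE : sg ^+ 2 + sg / 2 - 1 / 4 + p * q = 0.
  rewrite /sg /q; transitivity ((S ^+ 2 - (16 * p ^+ 2 - 8 * p + 5)) / 16).
    by field.
  by rewrite S2; field.
have sgn : sg <= - (3 / 4) by rewrite /sg; lra.
pose D := sg ^+ 2 - p * q.
have q0 : 0 <= q by rewrite /q; lra.
have D0 : D != 0 by apply/lt0r_neq0; rewrite /D /q; nra.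
(* Cramer's rule, with determinant [D], for the two equations in [c] and [c' = 1 - c], where [s - 1]
   is fixed as [sg]; [sgE] then yields both [c + c' = 1] and [s - 1 = sg]. *)
pose c := (p ^+ 2 - q * sg) / D.
have cE : c * D = p ^+ 2 - q * sg by rewrite divfK.
have [Dgt N1 N2] : [/\ 0 < D, 0 < p ^+ 2 - q * sg & 0 < q ^+ 2 - p * sg].
  by rewrite /D /q; split; nra.
have DE : D = sg ^+ 2 - p * q by [].
have qE : q = 1 / 2 - p by [].
clearbody c D.
have cE' : (1 - c) * D = q ^+ 2 - p * sg.
  transitivity (D - c * D); first by ring.
  by rewrite cE DE; move: sgE; rewrite /q; lra.
have sE : p * c + q * (1 - c) = sg + 1.
  apply: (mulIf D0); rewrite mulrDl -!mulrA cE cE' DE.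
  have -> : p * (p ^+ 2 - q * sg) + q * (q ^+ 2 - p * sg)
    = (sg + 1) * (sg ^+ 2 - p * q)
      - (sg + 1 / 2) * (sg ^+ 2 + sg / 2 - 1 / 4 + p * q).
    by rewrite /q; field.
  by rewrite sgE; ring.
(* [beta] solves [(p + q) * beta = gamma - q], where [p + q = 1 / 2] and [gamma = - (1 / 2) - sg];
   [y0] solves the equation at the empty word. *)
exists c, (2 * (p - sg - 1)),
  ((1 / 2 + (sg + 1) + 2 * p * (2 * (p - sg - 1))) / (1 - 2 * (sg + 1))).
rewrite /= -/q sE.
have E1 : p * (1 - c) + q + (sg + 1 - 1) * c = 0.
  apply: (mulIf D0); rewrite mul0r.
  transitivity (p * ((1 - c) * D) + q * D + sg * (c * D)); first by ring.
  by rewrite cE cE' DE; move: sgE; rewrite /q => sgE; lra.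
have E2 : q * c + p + (sg + 1 - 1) * (1 - c) = 0.
  apply: (mulIf D0); rewrite mul0r.
  transitivity (q * (c * D) + p * D + sg * ((1 - c) * D)); first by ring.
  by rewrite cE cE' DE; ring.
split => //.
- have h1 : 0 < c by rewrite -(pmulr_lgt0 _ Dgt) cE.
  have h2 : 0 < 1 - c by rewrite -(pmulr_lgt0 _ Dgt) cE'.
  by rewrite h1 /=; lra.
- by split; move: sgE; rewrite /q /sg; lra.
- rewrite mulrC; set Y := (X in X / _).
  have n0 : 1 - 2 * (sg + 1) != 0 by apply/lt0r_neq0; rewrite /sg; lra.
  have -> : Y / (1 - 2 * (sg + 1)) * (2 * (sg + 1) - 1) = - Y by field.
  by rewrite /Y /sg; field.
Qed.

(** * The potential of a word and its mean increment *)

Section Potential.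
Variables (R : realFieldType) (A B : groupType) (gen : pred (A + B)%type).
Variables (c beta y0 : R).

(** Folding from the left makes the last letter the outermost affine map, so that changing it leaves
    the value at the preceding word intact. *)
Definition corrector : seq (A + B) -> R :=
  foldl (fun y l => if gen l then c * y + beta else (1 - c) * y) y0.

Definition potential (w : seq (A + B)) : R := (size w)%:R + corrector w.

(** The ball of radius [C = |y0| + |beta| / (1 - c)] contains [y0] and is stable under both affine
    maps, since [|beta| <= (1 - c) * C]. *)
Lemma corrector_bounded : 0 < c < 1 -> exists C, forall w, `|corrector w| <= C.
Proof.
move=> /andP[c0 c1]; exists (`|y0| + `|beta| / (1 - c)).
have C0 : 0 <= `|beta| / (1 - c) by rewrite divr_ge0 // subr_ge0 ltW.
elim/last_ind => [|w l IH]; first by rewrite lerDl.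
rewrite /corrector foldl_rcons -/(corrector w).
set C := _ + _ in IH *; case: ifP => _.
  apply: le_trans (ler_normD _ _) _; rewrite normrM (ger0_norm (ltW c0)).
  have : `|beta| <= (1 - c) * C.
    rewrite -(ler_pdivrMl _ _ (_ : 0 < 1 - c)) ?subr_gt0 // mulrC.
    by rewrite lerDr.
  by have := normr_ge0 (corrector w); nra.
rewrite normrM ger0_norm; last by lra.
have := normr_ge0 (corrector w); nra.
Qed.

Lemma potential_step_bounded : 0 < c < 1 ->
  exists K, forall w m, reduced w -> letter_nontrivial m ->
  `|potential (word_mul w [:: m]) - potential w| <= K.
Proof.
move=> /corrector_bounded[C Cb]; exists (1 + C + C) => w m rw m1.
set w' := word_mul _ _.
have : (size w' <= (size w).+1)%N && (size w <= (size w').+1)%N.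
  rewrite {}/w'; case/lastP: w rw => [//|u l ru].
  rewrite word_mul_rcons // size_cat size_rcons; have := size_push l [:: m].
  by rewrite /=; lia.
rewrite -!(ler_nat R) -!natr1 /potential => /andP[h1 h2].
have := Cb w; have := Cb w'; rewrite !ler_norml => /andP[? ?] /andP[? ?].
by apply/andP; split; lra.
Qed.

End Potential.

Definition is_gen (A B : groupType) (a : A) (b : B) (l : A + B) : bool :=
  match l with inl x => x == a | inr y => y == b end.

(** One step in the factor of the last letter [l] cancels it, another exchanges generator and
    square, and the other two append a letter. All four values are affine in the corrector [y] of
    the word before [l]: the first two equations cancel the coefficient of [y], the next two fix the
    constant term, and the last one serves the empty word. *)
Lemma potential_drift (R : realFieldType) (z1 z2 : 'Z_3) (p c beta y0 gamma : R)
    (q := 1 / 2 - p) (s := p * c + q * (1 - c))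
    (F := potential (is_gen z1 z2) c beta y0) :
  generator [set: 'Z_3]%SET z1 -> generator [set: 'Z_3]%SET z2 ->
  p * (1 - c) + q + (s - 1) * c = 0 -> q * c + p + (s - 1) * (1 - c) = 0 ->
  p * beta + (s - 1) * beta = gamma - p -> q * beta + p * beta = gamma - q ->
  1 + (2 * s - 1) * y0 + 2 * p * beta = gamma ->
  forall w, reduced w ->
  p * F (word_mul w [:: inl z1]) + q * F (word_mul w [:: inl (z1 * z1)%g]) +
  (p * F (word_mul w [:: inr z2]) + q * F (word_mul w [:: inr (z2 * z2)%g]))
    = F w + gamma.
Proof.
move=> /generator_Z3[n1 n11 e1 a1] /generator_Z3[n2 n22 e2 a2] E1 E2 E3 E4 E5.
have e1' : (z1 * z1 * z1 = 1)%g by rewrite -mulgA.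
have e2' : (z2 * z2 * z2 = 1)%g by rewrite -mulgA.
have f1 : (z1 * z1 * (z1 * z1) = z1)%g by rewrite mulgA e1' mul1g.
have f2 : (z2 * z2 * (z2 * z2) = z2)%g by rewrite mulgA e2' mul1g.
have d1 : ((z1 * z1)%g == z1) = false.
  apply/negP => /eqP /(congr1 (mulg z1^-1)%g).
  by rewrite mulKg mulVg => /eqP; apply/negP.
have d2 : ((z2 * z2)%g == z2) = false.
  apply/negP => /eqP /(congr1 (mulg z2^-1)%g).
  by rewrite mulKg mulVg => /eqP; apply/negP.
elim/last_ind => [_|u l _ rul].
  rewrite /F /potential /corrector /word_mul /=.
  by rewrite !eqxx d1 d2 -E5 /s /q; field.
have l1 : letter_nontrivial l.
  by case/andP: rul => /allP /(_ l) h _; apply: h; rewrite mem_rcons mem_head.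
rewrite !word_mul_rcons //.
rewrite {}/F /potential /corrector !size_cat !foldl_cat size_rcons foldl_rcons.
rewrite -/(corrector _ c beta y0 u); set y := corrector _ _ _ _ _.
rewrite -natr1 !natrD.
move: l l1 {rul} => [t|t] /= t1.
  case: (a1 t t1) => ->; rewrite /push /= ?n1 ?n11 ?e1 ?e1' ?f1 ?eqxx ?n2 ?n22;
    rewrite ?(negPf n1) ?(negPf n11) /= ?eqxx ?d1 ?d2.
    move: (congr1 ( *%R y) E1) E3; rewrite /s /q; lra.
  move: (congr1 ( *%R y) E2) E4; rewrite /s /q; lra.
case: (a2 t t1) => ->; rewrite /push /= ?n1 ?n11 ?e2 ?e2' ?f2 ?eqxx ?n2 ?n22;
  rewrite ?(negPf n2) ?(negPf n22) /= ?eqxx ?d1 ?d2.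
  move: (congr1 ( *%R y) E1) E3; rewrite /s /q; lra.
move: (congr1 ( *%R y) E2) E4; rewrite /s /q; lra.
Qed.

(** * Inverse squares and moments of finite martingales *)

Lemma sum_inv_square_le2 (R : realFieldType) n :
  \sum_(0 <= k < n) (k%:R ^+ 2)^-1 <= 2 :> R.
Proof.
(* The sharper bound makes the induction telescope: [1 / a - 1 / (a + 1) >= 1 / (a + 1) ^+ 2]. The
   term [k = 0] is zero, as [0^-1 = 0]. *)
suff H : \sum_(0 <= k < n.+2) (k%:R ^+ 2)^-1 <= 2 - n.+1%:R^-1 :> R.
  apply: le_trans (le_trans H _); last by rewrite gerBl invr_ge0.
  rewrite [leRHS](big_cat_nat (n := n)) //=; last by lia.
  by rewrite lerDl sumr_ge0 // => k _; rewrite invr_ge0 sqr_ge0.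
elim: n => [|n IH].
  by rewrite !big_nat_recr //= big_geq //= expr0n /= invr0 expr1n invr1; lra.
rewrite big_nat_recr //=; apply: le_trans (lerD IH (lexx _)) _.
have a0 : 0 < n.+1%:R :> R by [].
rewrite -[n.+2]addn1 natrD; move: (n.+1%:R) a0 => a a0.
rewrite -subr_ge0; set X := (X in 0 <= X).
have -> : X = (a * (a + 1) ^+ 2)^-1.
  by rewrite /X; field; rewrite !lt0r_neq0 // addr_gt0.
by rewrite invr_ge0 mulr_ge0 ?sqr_ge0 ?ltW.
Qed.

Section FiniteMean.
Variables (R : realFieldType) (E : eqType) (S : seq E) (m : E -> R).

Fixpoint paths n : seq (seq E) :=
  if n is k.+1 then [seq rcons s i | s <- paths k, i <- S] else [:: [::]].

Definition path_weight (s : seq E) : R := \prod_(i <- s) m i.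

(** The expectation over [n] i.i.d. steps, as a finite sum: the moment bounds need no
    integration. *)
Definition mean n (y : seq E -> R) : R :=
  \sum_(s <- paths n) path_weight s * y s.

Lemma meanS n y :
  mean n.+1 y = mean n (fun s => \sum_(i <- S) m i * y (rcons s i)).
Proof.
rewrite /mean /= big_allpairs_dep; apply: eq_bigr => s _.
rewrite big_distrr /=; apply: eq_bigr => i _.
by rewrite /path_weight -cats1 big_cat big_seq1 mulrA.
Qed.

Hypothesis m_ge0 : forall i, 0 <= m i.
Hypothesis m1 : \sum_(i <- S) m i = 1.

Lemma path_weight_ge0 s : 0 <= path_weight s.
Proof. exact: prodr_ge0. Qed.

Lemma mean_le n y y' : (forall s, y s <= y' s) -> mean n y <= mean n y'.
Proof.
by move=> le_y; apply: ler_sum => s _; rewrite ler_wpM2l // path_weight_ge0.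
Qed.

Lemma mean_affine n (a b : R) y :
  mean n (fun s => a * y s + b) = a * mean n y + b.
Proof.
have mean1 : mean n (fun=> 1) = 1.
  elim: n => [|n IH].
    by rewrite /mean big_seq1 /path_weight big_nil mulr1.
  rewrite meanS -[RHS]IH /mean; apply: eq_bigr => s _; congr (_ * _).
  by rewrite -[RHS]m1; apply: eq_bigr => i _; rewrite mulr1.
transitivity (a * mean n y + b * mean n (fun=> 1)); last by rewrite mean1 mulr1.
rewrite /mean !big_distrr -big_split /=; apply: eq_bigr => s _; ring.
Qed.

Variables (M : seq E -> R) (K : R).
Hypothesis M0 : M [::] = 0.
Hypothesis M_martingale : forall s, \sum_(i <- S) m i * M (rcons s i) = M s.
Hypothesis M_step : forall s i, i \in S -> `|M (rcons s i) - M s| <= K.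

Let martingale_diff s : \sum_(i <- S) m i * (M (rcons s i) - M s) = 0.
Proof.
under eq_bigr do rewrite mulrBr.
by rewrite sumrB M_martingale -big_distrl /= m1 mul1r subrr.
Qed.

(** The cross term of the squared increment has mean zero, so each step adds at most [K ^+ 2]. *)
Lemma mean_martingale2 n : mean n (fun s => M s ^+ 2) <= K ^+ 2 * n%:R.
Proof.
elim: n => [|n IH].
  by rewrite /mean big_seq1 M0 expr0n /= !mulr0.
rewrite meanS -natr1 mulrDr mulr1.
apply: le_trans (lerD IH (lexx _)).
rewrite -[X in _ <= X + _]mul1r -mean_affine; apply: mean_le => s.
rewrite mul1r.
apply: (@le_trans _ _ (\sum_(i <- S)
    (m i * (M s ^+ 2 + K ^+ 2) + 2 * M s * (m i * (M (rcons s i) - M s))))).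
  rewrite big_seq [leRHS]big_seq; apply: ler_sum => i iS; have := M_step s iS.
  rewrite [X in _ <= _ + X]mulrCA -mulrDr ler_norml => /andP[? ?].
  by apply: ler_wpM2l => //; nra.
by rewrite big_split /= -big_distrl -big_distrr /= martingale_diff m1; lra.
Qed.

(** In [(y + D) ^+ 4] the term linear in [D] has mean zero and the later ones add at most
    [8 * K ^+ 2 * y ^+ 2 + 3 * K ^+ 4]. By the second moment bound the mean grows by at most
    [(8 * n + 3) * K ^+ 4], within the allowed [(16 * n + 8) * K ^+ 4]. *)
Lemma mean_martingale4 n : mean n (fun s => M s ^+ 4) <= 8 * K ^+ 4 * n%:R ^+ 2.
Proof.
elim: n => [|n IH].
  by rewrite /mean big_seq1 M0 !expr0n /= !mulr0.
have : mean n.+1 (fun s => M s ^+ 4) <=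
    mean n (fun s => M s ^+ 4) + 8 * K ^+ 2 * mean n (fun s => M s ^+ 2)
      + 3 * K ^+ 4.
  have -> : mean n (fun s => M s ^+ 4)
      + 8 * K ^+ 2 * mean n (fun s => M s ^+ 2) + 3 * K ^+ 4 =
     mean n (fun s => 1 * (M s ^+ 4 + 8 * K ^+ 2 * M s ^+ 2) + 3 * K ^+ 4).
    rewrite mean_affine mul1r /mean big_distrr /= -big_split /=; congr (_ + _).
    apply: eq_bigr => s _; ring.
  rewrite meanS; apply: mean_le => s; rewrite mul1r.
  apply: (@le_trans _ _ (\sum_(i <- S)
    (m i * (M s ^+ 4 + 8 * K ^+ 2 * M s ^+ 2 + 3 * K ^+ 4)
     + 4 * M s ^+ 3 * (m i * (M (rcons s i) - M s))))).
    rewrite big_seq [leRHS]big_seq; apply: ler_sum => i iS.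
    rewrite [X in _ <= _ + X]mulrCA -mulrDr.
    apply: ler_wpM2l => //.
    have D2 : (M (rcons s i) - M s) ^+ 2 <= K ^+ 2.
      rewrite -real_normK ?num_real //.
      by rewrite lerXn2r ?nnegrE ?(le_trans _ (M_step s iS)).
    move: (M s) (M (rcons s i) - M s) (subrK (M s) (M (rcons s i))) D2.
    move=> y D <- D2.
    have D4 : D ^+ 4 <= K ^+ 4.
      by rewrite !(exprM _ 2 2) lerXn2r ?nnegrE ?sqr_ge0.
    (* [4 y D^3 <= 2 y^2 D^2 + 2 D^4] *)
    have yD : 0 <= D ^+ 2 * (y - D) ^+ 2 by rewrite mulr_ge0 ?sqr_ge0.
    have yK : 0 <= y ^+ 2 * (K ^+ 2 - D ^+ 2).
      by rewrite mulr_ge0 ?sqr_ge0 ?subr_ge0.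
    by nra.
  by rewrite big_split /= -big_distrl -big_distrr /= martingale_diff m1; lra.
have := mean_martingale2 n; have := sqr_ge0 K; rewrite -natr1 => K0 h2 h4.
have : K ^+ 2 * mean n (fun s => M s ^+ 2) <= K ^+ 2 * (K ^+ 2 * n%:R).
  exact: ler_wpM2l.
have : 0 <= K ^+ 4 by rewrite (exprM _ 2 2) sqr_ge0.
have : 0 <= n%:R :> R by [].
nra.
Qed.

End FiniteMean.

(** * Strong law for bounded-increment martingales of i.i.d. steps *)

Section IidSteps.
Context {d d' : measure_display} {T : measurableType d} {E : measurableType d'}
  {R : realType} {P : probability T R}.
Variables (mu : probability E R) (x : nat -> {RV P >-> E}) (S : seq E).
Hypothesis measurable_singleton : forall g : E, measurable [set g].
Hypothesis iid_x : iid_of_law mu x.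

Definition steps n t : seq E := [seq x i t | i <- iota 0 n].

Lemma stepsS n t : steps n.+1 t = rcons (steps n t) (x n t).
Proof. by rewrite /steps -addn1 iotaD map_cat cats1. Qed.

Let event (s : seq E) : set T := [set t | steps (size s) t = s].
Let J n : {fset nat} := [fset i in iota 0 n]%fset.

(** A finite intersection of coordinate events is the form to which independence applies. *)
Let eventE s :
  event s = \bigcap_(i in [set` J (size s)]) (x i @^-1` [set nth point s i]).
Proof.
apply/seteqP; split=> t /=.
  move=> ts i /=; rewrite /J in_fset mem_iota /= add0n => i_s.
  by rewrite -[in RHS]ts (nth_map 0%N) ?size_iota // nth_iota.
move=> ts; apply: (@eq_from_nth _ point); first by rewrite size_map size_iota.
rewrite size_map size_iota => i i_s; rewrite (nth_map 0%N) ?size_iota //.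
by rewrite nth_iota //=; apply: ts; rewrite /J /= in_fset mem_iota.
Qed.

Let measurable_step i (C : set E) : measurable C -> measurable (x i @^-1` C).
Proof. by move=> mC; rewrite -[_ @^-1` _]setTI; exact: measurable_funPT. Qed.

Let measurable_event s : measurable (event s).
Proof.
rewrite eventE; apply: fin_bigcap_measurable; first exact: finite_fset.
by move=> i _; exact: measurable_step.
Qed.

Definition step_law (g : E) : R := fine (mu [set g]).

Let prob_event s : P (event s) = (path_weight step_law s)%:E.
Proof.
have [law indep] := iid_x.
rewrite eventE (indep _ (fun i => [set nth point s i])) //.
have JE : perm_eq (J (size s)) (iota 0 (size s)).
  apply: uniq_perm; rewrite ?fset_uniq ?iota_uniq // => i.
  by rewrite /J in_fset.
rewrite (perm_big _ JE) /= /path_weight [in RHS](big_nth point) -prodEFin.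
rewrite /index_iota subn0; apply: eq_bigr => i _.
by rewrite /step_law fineK ?fin_num_measure // -(law i).
Qed.

Hypothesis uniq_S : uniq S.
Hypothesis mu_S : \sum_(g <- S) step_law g = 1.

Let step_law_ge0 g : 0 <= step_law g.
Proof. exact: fine_ge0. Qed.

(** The masses on [S] add up to one, so each step leaves [S] with probability zero, and countably
    many null sets are discarded. *)
Lemma ae_steps_in : {ae P, forall t n, x n t \in S}.
Proof.
apply: ae_foralln => n; have [law _] := iid_x.
have mS : measurable [set` S].
  rewrite -[X in measurable X]image_id -bigcup_imset1.
  by apply: fin_bigcup_measurable.
exists (x n @^-1` ~` [set` S]); split; first exact/measurable_step/measurableC.
  rewrite [LHS](_ : _ = mu (~` [set` S])); last first.
    by rewrite -(law n) //; exact: measurableC.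
  rewrite probability_setC // -[X in mu X]image_id -bigcup_imset1.
  rewrite measure_fin_bigcup //; first last.
  - by move=> i j _ _ [z [/= -> ->]].
  - exact: finite_seq.
  rewrite -fsbig_seq //.
  have -> : (\sum_(g <- S) mu [set g] = (\sum_(g <- S) step_law g)%:E)%E.
    rewrite -sumEFin; apply: eq_bigr => g _.
    by rewrite /step_law fineK ?fin_num_measure.
  by rewrite mu_S subee.
by move=> t /= tS.
Qed.

Variables (M : seq E -> R) (K : R).
Hypothesis M0 : M [::] = 0.
Hypothesis M_martingale :
  forall s, \sum_(g <- S) step_law g * M (rcons s g) = M s.
Hypothesis M_step : forall s g, g \in S -> `|M (rcons s g) - M s| <= K.

(* [Z n] is almost surely [(M_n / n) ^+ 4], but visibly a simple function: no
   measurability of the walk itself is needed. *)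
Let Z n (t : T) : R :=
  \sum_(s <- paths S n) (M s / n%:R) ^+ 4 * \1_(event s) t.

Let Z_ge0 n t : 0 <= Z n t.
Proof.
by apply: sumr_ge0 => s _; rewrite mulr_ge0 // (exprM _ 2 2) sqr_ge0.
Qed.

Let Z_summand_measurable n (s : seq E) : measurable_fun setT
  ((fun t => (((M s / n%:R) ^+ 4)%:E * (\1_(event s) t)%:E)%E)
    : T -> \bar R).
Proof.
apply: measurable_funeM; apply/measurable_EFinP; exact: measurable_indic.
Qed.

Let Z_E n t : (Z n t)%:E =
  (\sum_(s <- paths S n) ((M s / n%:R) ^+ 4)%:E * (\1_(event s) t)%:E)%E.
Proof. by rewrite -sumEFin; apply: eq_bigr => s _; rewrite EFinM. Qed.

Let Z_measurable n : measurable_fun setT ((fun t => (Z n t)%:E) : T -> \bar R).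
Proof.
under eq_fun do rewrite Z_E.
by apply: emeasurable_sum => s.
Qed.

Let integral_Z n :
  (\int[P]_t (Z n t)%:E <= (8 * K ^+ 4 * (n%:R ^+ 2)^-1)%:E)%E.
Proof.
under eq_integral do rewrite Z_E.
rewrite ge0_integral_sum //; last first.
  by move=> s t _; rewrite -EFinM lee_fin mulr_ge0 // (exprM _ 2 2) sqr_ge0.
have -> : (\sum_(s <- paths S n)
    \int[P]_t (((M s / n%:R) ^+ 4)%:E * (\1_(event s) t)%:E) =
    (mean S step_law n (fun s => M s ^+ 4) / n%:R ^+ 4)%:E)%E.
  rewrite /mean big_distrl -sumEFin; apply: eq_bigr => s _.
  rewrite ge0_integralZl_EFin //; last by rewrite (exprM _ 2 2) sqr_ge0.
    2: by apply/measurable_EFinP; exact: measurable_indic.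
  have -> : (\int[P]_t (\1_(event s) t)%:E = (path_weight step_law s)%:E)%E.
    by rewrite integral_indic // setIT; exact: prob_event.
  rewrite -EFinM expr_div_n.
  by rewrite /=; congr EFin; ring.
(* At [n = 0] both sides vanish because [0^-1 = 0]. *)
rewrite lee_fin; case: n => [|n].
  by rewrite !expr0n /= !invr0 !mulr0.
rewrite ler_pdivrMr ?exprn_gt0 //.
have -> : 8 * K ^+ 4 * (n.+1%:R ^+ 2)^-1 * n.+1%:R ^+ 4 =
    8 * K ^+ 4 * n.+1%:R ^+ 2 by field.
exact: mean_martingale4.
Qed.

(** The integrals of the [Z n] are dominated by inverse squares, so the series has finite integral;
    it is almost surely finite and its terms tend to zero. *)
Let ae_Z_cvg : {ae P, forall t, Z n t @[n --> \oo] --> 0}.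
Proof.
have fin : P.-integrable setT (fun t => \sum_(0 <= n <oo) (Z n t)%:E)%E.
  apply/integrableP; split.
    by apply: ge0_emeasurable_sum => // n t _ _; rewrite lee_fin.
  have Z0 t : (0 <= \sum_(0 <= n <oo) (Z n t)%:E)%E.
    by apply: nneseries_ge0 => n _ _; rewrite lee_fin.
  under eq_integral do rewrite gee0_abs //.
  rewrite integral_nneseries //; last by move=> n t _; rewrite lee_fin.
  apply: (@le_lt_trans _ _ (8 * K ^+ 4 * 2)%:E); last exact: ltry.
  apply: lime_le.
    apply: is_cvg_nneseries => n _ _.
    by apply: integral_ge0 => t _; rewrite lee_fin.
  apply: nearW => n.
  apply: (@le_trans _ _ (\sum_(0 <= k < n) (8 * K ^+ 4 * (k%:R ^+ 2)^-1)%:E)%E).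
    by apply: lee_sum => k _.
  rewrite sumEFin lee_fin -mulr_sumr ler_wpM2l ?sum_inv_square_le2 //.
  by rewrite mulr_ge0 // (exprM _ 2 2) sqr_ge0.
have := integrable_ae measurableT fin; apply: filterS => t /(_ I) Zfin.
apply: cvg_series_cvg_0; apply: nnseries_is_cvg => //.
by rewrite ltey_eq Zfin.
Qed.

Lemma bounded_martingale_slln :
  {ae P, forall t, M (steps n t) / n%:R @[n --> \oo] --> 0}.
Proof.
have ae_S := ae_steps_in; have ae_Z := ae_Z_cvg.
apply: filterS2 ae_S ae_Z => t St.
have st n : steps n t \in paths S n.
  elim: n => [|n IH]; first by rewrite mem_head.
  rewrite stepsS; apply/allpairsP; exists (steps n t, x n t).
  by split=> //; exact: St.
(* The left side is the summand of the path actually taken; the other summands are nonnegative. *)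
have MZ n : (M (steps n t) / n%:R) ^+ 4 <= Z n t.
  rewrite /Z (perm_big _ (perm_to_rem (st n))) big_cons.
  have -> : \1_(event (steps n t)) t = 1 :> R.
    by rewrite indicE mem_set //= /event /= {1}/steps size_map size_iota.
  rewrite mulr1.
  rewrite lerDl sumr_ge0 // => s _.
  by rewrite mulr_ge0 // (exprM _ 2 2) sqr_ge0.
move=> /cvgr0Pnorm_lt Z0; apply/cvgr0Pnorm_lt => e e0.
have : \forall n \near \oo, `|Z n t| < e ^+ 4 by apply: Z0; rewrite exprn_gt0.
apply: filterS => n; rewrite ger0_norm // => Zn.
rewrite -(@ltr_pXn2r _ 4) ?nnegrE //; last exact: ltW.
by rewrite -normrX ger0_norm ?(le_lt_trans (MZ n)) // (exprM _ 2 2) sqr_ge0.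
Qed.

End IidSteps.

(** * From the martingale to the drift *)

Lemma walk_steps d (T : measurableType d) (R : realType) (P : probability T R)
    (A B : groupType) (x : nat -> {RV P >-> free_product A B}) n t :
  walk x n t = (\prod_(g <- steps x n t) g)%g.
Proof.
elim: n => [|n IH]; first by rewrite /steps big_nil.
by rewrite stepsS -cats1 big_cat big_seq1 /= IH.
Qed.

Lemma cvg_add_bounded_over_n (R : realType) (u v : nat -> R) (l K : R) :
  (forall n, `|u n - v n - l * n%:R| <= K) ->
  v n / n%:R @[n --> \oo] --> 0 -> u n / n%:R @[n --> \oo] --> l.
Proof.
move=> uvK v0.
have K0 : 0 <= K by apply: le_trans (uvK 0%N).
pose w n := u n / n%:R - v n / n%:R - l.
have w0 : w n @[n --> \oo] --> 0.
  (* [harmonic n] is [1 / (n + 1)]: the factor 2 absorbs [1 / n <= 2 / (n + 1)], and [|l|] covers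
     [n = 0], where division by zero gives [w 0 = - l]. *)
  have h0 : (2 * K + `|l|) * harmonic n @[n --> \oo] --> 0.
    rewrite -[0 in X in _ --> X](mulr0 (2 * K + `|l|)).
    exact: cvgMr cvg_harmonic.
  apply/norm_cvg0P; apply: squeeze_cvgr (cvg_cst 0) h0.
  apply: nearW => n; rewrite normr_ge0 /= /w; case: n => [|n].
    by rewrite !invr0 !mulr0 subrr sub0r normrN invr1 mulr1 lerDr mulr_ge0.
  have n0 : 0 < n.+1%:R :> R by [].
  have -> : u n.+1 / n.+1%:R - v n.+1 / n.+1%:R - l =
      (u n.+1 - v n.+1 - l * n.+1%:R) / n.+1%:R by field.
  rewrite normrM normfV (gtr0_norm n0) ler_pdivrMr //.
  apply: le_trans (uvK _) _; rewrite -mulrA.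
  have h : 1 <= 2 * (n.+2%:R^-1 * n.+1%:R) :> R.
    by rewrite mulrCA mulrC ler_pdivlMr // mul1r -natrM ler_nat; lia.
  move: (_^-1 * _) h => X h; have := normr_ge0 l; nra.
have -> : (fun n => u n / n%:R) = (fun n => v n / n%:R + (l + w n)).
  by apply/funext => n; rewrite /w; ring.
rewrite -[l in X in _ --> X]add0r -[l in X in _ --> X]addr0.
by apply: cvgD => //; apply: cvgD => //; exact: cvg_cst.
Qed.

Theorem mainTheorem4 (R : realType) (d : measure_display)
    (T : measurableType d) (P : probability T R)
    (z1 z2 : 'Z_3)
    (gen_z1 : generator [set: 'Z_3]%SET z1)
    (gen_z2 : generator [set: 'Z_3]%SET z2)
    (a b : free_product 'Z_3 'Z_3)
    (def_a : a = fp_inl z1) (def_b : b = fp_inr z2)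
    (p : R) (p_ge0 : 0 <= p) (p_le : p <= 1 / 2)
    (mu : probability (free_product 'Z_3 'Z_3) R)
    (mu_a : mu [set a] = p%:E) (mu_b : mu [set b] = p%:E)
    (mu_a2 : mu [set (a ^+ 2)%g] = (1 / 2 - p)%:E)
    (mu_b2 : mu [set (b ^+ 2)%g] = (1 / 2 - p)%:E)
    (x : nat -> {RV P >-> free_product 'Z_3 'Z_3})
    (iid_x : iid_of_law mu x) :
  is_drift P [set a; (a ^+ 2)%g; b; (b ^+ 2)%g] x
    (- (1 / 4) + 1 / 4 * Num.sqrt (16 * p ^+ 2 - 8 * p + 5)).
Proof.
set gamma := _ + _ * _.
have [n1 n11 _ a1] := generator_Z3 gen_z1.
have [n2 n22 _ a2] := generator_Z3 gen_z2.
have a2E : (a ^+ 2)%g = fp_letter (inl (z1 * z1)%g).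
  by rewrite def_a expgS expg1 -fp_inlM.
have b2E : (b ^+ 2)%g = fp_letter (inr (z2 * z2)%g).
  by rewrite def_b expgS expg1 -fp_inrM.
have aE : a = fp_letter (inl z1) by [].
have bE : b = fp_letter (inr z2) by [].
pose ls : seq ('Z_3 + 'Z_3) :=
  [:: inl z1; inl (z1 * z1)%g; inr z2; inr (z2 * z2)%g].
have ls1 : all (@letter_nontrivial _ _) ls by rewrite /= n1 n11 n2 n22.
pose S : seq (free_product 'Z_3 'Z_3) := [seq fp_letter l | l <- ls].
(* Nontrivial elements of ['Z_3] are the generator and its square, so these four elements are all
   the letters and word length is normal form length. *)
have SE : [set a; (a ^+ 2)%g; b; (b ^+ 2)%g] =
    [set fp_letter l | l in [set l | letter_nontrivial l]].
  rewrite a2E b2E aE bE; apply/seteqP; split=> g.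
    by move=> [[[|]|]|] ->; apply: imageP.
  move=> [[t|t] /= t1 <-].
    by case: (a1 t t1) => ->; [left; left; left|left; left; right].
  by case: (a2 t t1) => ->; [left; right|right].
have uniq_S : uniq S.
  rewrite map_inj_in_uniq; last first.
    move=> l m /(allP ls1) l1 /(allP ls1) m1 /(congr1 val).
    by rewrite !val_fp_letter // => -[].
  have zz (z : 'Z_3) : z != 1%g -> z != (z * z)%g.
    by apply: contra => /eqP zz; apply/eqP/(mulgI z); rewrite mulg1 -zz.
  by rewrite /= !inE !(inj_eq inl_inj) ?(inj_eq inr_inj) (negPf (zz _ n1)) zz.
have [c [beta [y0 /= [c01 E1 E2 [E3 E4] E5]]]] := drift_coefficients p_ge0 p_le.
pose F (g : free_product 'Z_3 'Z_3) :=
  potential (is_gen z1 z2) c beta y0 (val g).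
pose M s := F (\prod_(g <- s) g)%g - F 1%g - gamma * (size s)%:R.
have SF (f : free_product 'Z_3 'Z_3 -> R) :
    \sum_(g <- S) step_law mu g * f g =
    p * f a + (1 / 2 - p) * f (a ^+ 2)%g +
    (p * f b + (1 / 2 - p) * f (b ^+ 2)%g).
  rewrite !big_cons big_nil addr0 addrA -a2E -b2E -aE -bE /step_law.
  by rewrite mu_a mu_a2 mu_b mu_b2.
have law1 : \sum_(g <- S) step_law mu g = 1.
  have := SF (fun=> 1); under eq_bigr do rewrite mulr1.
  by move=> ->; field.
have valM (g : free_product 'Z_3 'Z_3) l : l \in ls ->
    val (g * fp_letter l)%g = word_mul (val g) [:: l].
  by move=> /(allP ls1) l1; rewrite -(val_fp_letter l1).
have F_drift g : \sum_(h <- S) step_law mu h * F (g * h)%g = F g + gamma.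
  rewrite (SF (fun h => F (g * h)%g)) a2E b2E aE bE /F.
  rewrite !valM ?inE ?eqxx ?orbT //.
  exact: (potential_drift gen_z1 gen_z2 E1 E2 E3 E4 E5 (valP g)).
have M_rcons s g : M (rcons s g) =
    F (\prod_(h <- s) h * g)%g - F 1%g - gamma * (size s)%:R - gamma.
  by rewrite /M size_rcons -cats1 big_cat big_seq1 -natr1; ring.
have M_mart s : \sum_(g <- S) step_law mu g * M (rcons s g) = M s.
  under eq_bigr do rewrite M_rcons -2!addrA mulrDr.
  by rewrite big_split /= F_drift -big_distrl /= law1 /M; ring.
have [K FK] := potential_step_bounded (is_gen z1 z2) beta y0 c01.
have M_step s g : g \in S -> `|M (rcons s g) - M s| <= K + `|gamma|.
  move=> /mapP[l lls ->]; rewrite M_rcons.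
  set h := (\prod_(_ <- _) _)%g.
  have -> : F (h * fp_letter l)%g - F 1%g - gamma * (size s)%:R - gamma - M s =
      F (h * fp_letter l)%g - F h - gamma by rewrite /M -/h; ring.
  apply: le_trans (ler_normB _ _) _; rewrite lerD2r /F valM //.
  by apply: FK; [exact: valP|exact: (allP ls1)].
have M0 : M [::] = 0 by rewrite /M big_nil subrr mulr0 subr0.
have [C FC] := corrector_bounded (is_gen z1 z2) beta y0 c01.
rewrite /is_drift SE.
have mG (g : free_product 'Z_3 'Z_3) : measurable [set g] by [].
have := bounded_martingale_slln mG iid_x uniq_S law1 M0 M_mart M_step.
apply: filterS => t.
(* The length differs from [M_n + gamma * n] by [F 1] minus the corrector, and the latter is bounded
   by [C]. *)
apply: (@cvg_add_bounded_over_n _ _ _ _ (C + `|F 1%g|)) => n.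
rewrite word_length_free_product walk_steps /M size_map size_iota.
set w := val _.
have -> : (size w)%:R
    - (F (\prod_(g <- steps x n t) g)%g - F 1%g - gamma * n%:R)
    - gamma * n%:R = - corrector (is_gen z1 z2) c beta y0 w + F 1%g.
  by rewrite {1}/F /potential -/w; ring.
by apply: le_trans (ler_normD _ _) _; rewrite normrN lerD2r.
Qed.
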